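(* Let $n\ge1$, $r\in(1,\infty)$, and let $V$ be a finite positive measure on $\mathbb{R}^n$ absolutely continuous with respect to Lebesgue measure. Suppose $g$ is a positive radial function on $\mathbb{R}^n$ that is decreasing in the radial direction. If $T_g$ is bounded from $L^1(\mathbb{R}^n)$ to $L^{r,\infty}(\mathbb{R}^n)$, then: (1) $g\in L^{r,\infty}$ and $\|g\|_{L^{r,\infty}}\le C\|T_g\|_{L^1\to L^{r,\infty}}$ with $C$ an absolute constant; (2) for every $\lambda>0$, $\liminf_{t\to0^+}|\{x\in\mathbb{R}^n:|T_gV_t(x)|>\lambda\}|\ge|\{x\in\mathbb{R}^n:|g(x)|V(\mathbb{R}^n)>\lambda\}|$; (3) for every $\lambda>0$, $\limsup_{t\to0^+}|\{x\in\mathbb{R}^n:|T_gV_t(x)|>\lambda\}|\le|\{x\in\mathbb{R}^n:|g(x)|V(\mathbb{R}^n)\ge\lambda\}|$.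
   Context: $T_g(\mu)(x)=\int_{\mathbb{R}^n}g(x-y)\,d\mu(y)$ (for functions, $T_gf=g*f$). $V_t(E)=V(E/t)$ with $E/t=\{x/t:x\in E\}$. $L^{r,\infty}$ is weak $L^r$ with quasinorm $\sup_{\lambda>0}\lambda|\{|f|>\lambda\}|^{1/r}$. *)

(* Defs.v *)
From HB Require Import structures.
From mathcomp Require Import all_boot all_order all_algebra.
From mathcomp Require Import all_classical all_reals all_analysis.
Set Implicit Arguments. Unset Strict Implicit. Unset Printing Implicit Defensive.
Import Order.TTheory GRing.Theory Num.Theory.
Import numFieldNormedType.Exports.
Local Open Scope classical_set_scope.
Local Open Scope ring_scope.

Definition Rn (R : realType) (n : nat) : measurableType _ :=
  g_sigma_algebraType (@open 'rV[R]_n).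

Definition enorm (R : realType) (n : nat) (x : 'rV[R]_n) : R :=
  Num.sqrt (\sum_(i < n) (x ord0 i) ^+ 2).

(* lam is (the Borel restriction of) Lebesgue measure on R^n:
   it gives every half-open box its volume.  This determines lam uniquely. *)
Definition is_lebesgue (R : realType) (n : nat)
    (lam : {measure set Rn R n -> \bar R}) : Prop :=
  forall a b : 'rV[R]_n, (forall i, a ord0 i <= b ord0 i) ->
    lam [set x : Rn R n | forall i, a ord0 i < (x : 'rV[R]_n) ord0 i <= b ord0 i]
    = (\prod_(i < n) (b ord0 i - a ord0 i))%:E.

(* g is a positive radial function, decreasing in the radial direction
   (radial profile phi, nonincreasing on (0,+oo); the value g 0 is only
   required to be positive). *)
Definition pos_radial_decreasing (R : realType) (n : nat) (g : Rn R n -> R) : Prop :=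
  (forall x, 0 < g x) /\
  exists phi : R -> R,
    (forall s u, 0 < s -> s <= u -> phi u <= phi s) /\
    (forall x : Rn R n, x != 0 :> 'rV[R]_n -> g x = phi (enorm (x : 'rV[R]_n))).

Local Open Scope ereal_scope.

Definition Tg_meas (R : realType) (n : nat) (g : Rn R n -> R)
    (mu : set (Rn R n) -> \bar R) (x : Rn R n) : \bar R :=
  \int[mu]_y (g ((x : 'rV[R]_n) - (y : 'rV[R]_n)))%:E.

Definition Tg_fun (R : realType) (n : nat) (lam : set (Rn R n) -> \bar R)
    (g : Rn R n -> R) (f : Rn R n -> R) (x : Rn R n) : \bar R :=
  \int[lam]_y ((g ((x : 'rV[R]_n) - (y : 'rV[R]_n)) * f y)%R)%:E.

Definition dil (R : realType) (n : nat) (V : set (Rn R n) -> \bar R) (t : R)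
    : set (Rn R n) -> \bar R :=
  pushforward V (fun y : Rn R n => (t *: (y : 'rV[R]_n) : Rn R n)).

Definition weak_norm (R : realType) (n : nat) (lam : set (Rn R n) -> \bar R)
    (r : R) (F : Rn R n -> \bar R) : \bar R :=
  ereal_sup [set l%:E * (lam [set x | l%:E < `|F x|]) `^ (r^-1)
            | l in [set l : R | (0 < l)%R]].

Definition L1_norm (R : realType) (n : nat) (lam : {measure set Rn R n -> \bar R})
    (f : Rn R n -> R) : \bar R :=
  \int[lam]_x `|(f x)%:E|.

(* operator norm of T_g : L^1 -> L^{r,oo} (+oo if unbounded) *)
Definition Tg_opnorm (R : realType) (n : nat) (lam : {measure set Rn R n -> \bar R})
    (r : R) (g : Rn R n -> R) : \bar R :=
  ereal_inf [set A%:E | A in [set A : R | (0 <= A)%R /\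
     forall f : Rn R n -> R, lam.-integrable setT (EFin \o f) ->
       weak_norm lam r (Tg_fun lam g f) <= A%:E * L1_norm lam f]].

(* Main.v *)
Require Import Defs.
From HB Require Import structures.
From mathcomp Require Import all_boot all_order all_algebra.
From mathcomp Require Import all_classical all_reals all_analysis.
From mathcomp Require Import measurable_realfun ring lra.
Import Order.TTheory GRing.Theory Num.Theory.
Import numFieldNormedType.Exports.
Local Open Scope classical_set_scope.
Local Open Scope ring_scope.

(* Let B_s be the open ball of radius s centered at 0; by scaling, |B_s| = s^n |B_1|
   takes every value in (0, +oo).  If |B_u| < |{g > l}|, then some point outside B_u
   lies in {g > l}, so g is bounded below on B_u minus the origin by some c > l.  Then
   T_g m >= c m(B_(u - s)) on B_s for every finite measure m without atoms.
   Applied to Lebesgue measure on a small ball this gives (1) with C = 1, and applied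
   to V_t, which concentrates at 0, it gives (2).
   For (3), if |B_s| > |{g V(R^n) >= l}|, then g <= c outside B_s with c V(R^n) < l.
   Off B_u with u > s, the part of V_t in B_(u - s) contributes at most c V(R^n),
   while the rest is absolutely continuous with small mass, hence by Radon-Nikodym
   and the weak type bound its contribution exceeds l - c V(R^n) only on a small set. *)

(** * Borel sets of R^n and half-open boxes *)

Section Borel.
Context {R : realType} {n : nat}.

Lemma open_measurable_Rn (U : set 'rV[R]_n) :
  open U -> measurable (U : set (Rn R n)).
Proof. by move=> oU; apply: sub_sigma_algebra. Qed.

Lemma continuous_measurable_Rn (f : 'rV[R]_n -> R) :
  continuous f -> measurable_fun setT (f : Rn R n -> R).
Proof.
move=> cf; apply: (measurability (@RGenOInfty.G R)).
  exact: RGenOInfty.measurableE.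
move=> _ [_ [r ->] <-]; rewrite setTI; apply: open_measurable_Rn.
by move/continuousP: cf; apply; rewrite set_itvoy; exact: open_gt.
Qed.

Lemma measurable_coord (i : 'I_n) :
  measurable_fun setT (fun x : Rn R n => (x : 'rV[R]_n) ord0 i).
Proof. by apply: continuous_measurable_Rn; exact: coord_continuous. Qed.

Definition hbox (a b : 'rV[R]_n) : set (Rn R n) :=
  [set x : Rn R n | forall i, a ord0 i < (x : 'rV[R]_n) ord0 i <= b ord0 i].

Definition hboxes : set (set (Rn R n)) :=
  [set hbox ab.1 ab.2 | ab in [set ab : 'rV[R]_n * 'rV[R]_n |
     forall i, ab.1 ord0 i <= ab.2 ord0 i]].

Lemma hbox_measurable (a b : 'rV[R]_n) : measurable (hbox a b).
Proof.
have -> : hbox a b = \bigcap_(i in [set: 'I_n])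
    ((fun x : Rn R n => (x : 'rV[R]_n) ord0 i) @^-1` `]a ord0 i, b ord0 i]).
  by apply/seteqP; split => [x xab i _|x xab i]; [|have := xab i I];
    rewrite /= in_itv /=.
apply: fin_bigcap_measurable => // i _.
by rewrite -[X in measurable X]setTI; exact: measurable_coord.
Qed.

Lemma hboxes_setI_closed : setI_closed hboxes.
Proof.
move=> _ _ [[a b] /= ab <-] [[c d] /= cd <-].
(* The outer [Num.max] in the upper corner keeps the corners ordered when the boxes are disjoint. A
   coordinate with no overlap then has equal endpoints, so the half-open box is empty, as it should
   be. *)
exists (\row_i Num.max (a ord0 i) (c ord0 i),
  \row_i Num.max (Num.max (a ord0 i) (c ord0 i))
                 (Num.min (b ord0 i) (d ord0 i))) => /=.
  by move=> i; rewrite !mxE le_max lexx.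
apply/seteqP; split => [x|x [xab xcd] i].
  move=> xI.
  suff xabcd i : (a ord0 i < x ord0 i <= b ord0 i) && (c ord0 i < x ord0 i <= d ord0 i).
    by split => i; have /andP[] := xabcd i.
  have := xI i; rewrite !mxE le_max => /andP[mx]; rewrite leNgt mx /= le_min.
  by move: mx; rewrite gt_max => /andP[-> ->] /andP[-> ->].
by rewrite !mxE gt_max le_max le_min; have /andP[-> ->] := xab i;
  have /andP[-> ->] := xcd i; rewrite orbT.
Qed.

(** Every open set is the union of the boxes with rational corners that it contains, and there are
    countably many of them. [F] is indexed by all pairs of rational corners and takes the value
    [set0] on the pairs that do not qualify. *)
Lemma open_hboxes (U : set 'rV[R]_n) : open U -> <<s hboxes >> (U : set (Rn R n)).
Proof.
move=> oU; pose q2r (p : 'rV[rat]_n) : 'rV[R]_n := \row_i ratr (p ord0 i).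
pose F (pq : 'rV[rat]_n * 'rV[rat]_n) : set (Rn R n) :=
  if pselect ((forall i, pq.1 ord0 i <= pq.2 ord0 i)
     /\ hbox (q2r pq.1) (q2r pq.2) `<=` U) then hbox (q2r pq.1) (q2r pq.2)
  else set0.
have -> : U = \bigcup_pq F pq.
  apply/seteqP; split => [x Ux|x [pq _]]; last first.
    by rewrite /F; case: pselect => //= -[_]; apply.
  have : nbhs x U by rewrite nbhsE /=; exists U.
  move/nbhs_ballP => [e /= e0 eU].
  (* Rational corners are taken strictly within [e] of [x] on either side. The box then contains [x]
     and lies in the sup-norm ball of radius [e]. *)
  have xp i : {p : rat | ratr p \in `]x ord0 i - e, x ord0 i[}.
    by apply/cid/rat_in_itvoo; rewrite ltrBlDr ltrDl.
  have xq i : {q : rat | ratr q \in `]x ord0 i, x ord0 i + e[}.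
    by apply/cid/rat_in_itvoo; rewrite ltrDl.
  exists (\row_i sval (xp i), \row_i sval (xq i)) => //.
  rewrite /F; case: pselect => /=.
    move=> _ i; rewrite !mxE; case: (xp i) => p /=; case: (xq i) => q /=.
    by rewrite !in_itv /= => /andP[/ltW-> _] /andP[_ ->].
  case; split.
    move=> i; rewrite !mxE -(ler_rat R); case: (xp i) => p /=; case: (xq i) => q /=.
    by rewrite !in_itv /= => /andP[/ltW xq' _] /andP[_ px]; rewrite ltW// (lt_le_trans px).
  move=> y /= ypq; apply: eU; split => // j i; rewrite !ord1.
  have := ypq i; rewrite !mxE; case: (xp i) => p /=; case: (xq i) => q /=.
  rewrite !in_itv /= => /andP[xq' qx] /andP[px px'] /andP[py yq].
  by rewrite /ball /= ltr_norml; apply/andP; split; lra.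
apply: (@countable_bigcupT_measurable _ (g_sigma_algebraType hboxes)).
  exact: countableP.
move=> pq; rewrite /F; case: pselect => //= -[pq12 _].
apply: sub_sigma_algebra; exists (q2r pq.1, q2r pq.2) => //= i.
by rewrite !mxE ler_rat.
Qed.

Lemma measurable_hboxesE :
  (measurable : set (set (Rn R n))) = <<s hboxes >>.
Proof.
apply/seteqP; split.
  by apply: smallest_sub; [exact: smallest_sigma_algebra|exact: open_hboxes].
apply: smallest_sub => [|_ [[a b] _ <-]]; last exact: hbox_measurable.
exact: sigma_algebra_measurable.
Qed.

(** Boxes generate the sigma-algebra, and the preimage of a box is a finite intersection of
    coordinate preimages. *)
Lemma measurable_fun_Rn d (T : measurableType d) (f : T -> Rn R n) :
  (forall i, measurable_fun setT (fun t => (f t : 'rV[R]_n) ord0 i)) ->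
  measurable_fun setT f.
Proof.
move=> mf; apply: (measurability _ measurable_hboxesE).
move=> _ [_ [[a b] _ <-] <-]; rewrite setTI.
have -> : f @^-1` hbox a b = \bigcap_(i in [set: 'I_n])
    ((fun t => (f t : 'rV[R]_n) ord0 i) @^-1` `]a ord0 i, b ord0 i]).
  by apply/seteqP; split => [x xab i _|x xab i]; [have := xab i|have := xab i I];
    rewrite /= in_itv /=.
apply: fin_bigcap_measurable => // i _.
by rewrite -[X in measurable X]setTI; exact: mf.
Qed.

End Borel.

(** * The Euclidean norm and its balls *)

Section EuclideanNorm.
Context {R : realType} {n : nat}.
Implicit Types x y : 'rV[R]_n.

Lemma enorm_ge0 x : 0 <= enorm x.
Proof. exact: sqrtr_ge0. Qed.

Lemma sqr_enorm x : enorm x ^+ 2 = \sum_(i < n) x ord0 i ^+ 2.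
Proof. by rewrite sqr_sqrtr// sumr_ge0// => i _; rewrite sqr_ge0. Qed.

Lemma ler_coord_enorm x i : `|x ord0 i| <= enorm x.
Proof.
rewrite -(@ler_pXn2r _ 2)// ?nnegrE ?enorm_ge0// sqr_enorm real_normK ?num_real//.
by rewrite (bigD1 i)//= lerDl sumr_ge0// => j _; rewrite sqr_ge0.
Qed.

Lemma enorm_gt0 x : x != 0 -> 0 < enorm x.
Proof.
move=> x0; rewrite lt_neqAle enorm_ge0 andbT eq_sym; apply: contra x0 => /eqP e0.
apply/eqP/rowP => i; rewrite mxE; apply/eqP; rewrite -normr_le0 -e0.
exact: ler_coord_enorm.
Qed.

Lemma enormZ t x : enorm (t *: x) = `|t| * enorm x.
Proof.
rewrite /enorm; under eq_bigr do rewrite mxE exprMn.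
by rewrite -mulr_sumr sqrtrM ?sqr_ge0// sqrtr_sqr.
Qed.

Lemma enormN x : enorm (- x) = enorm x.
Proof. by rewrite -scaleN1r enormZ normrN1 mul1r. Qed.

Lemma dot_le_enorm x y : \sum_(i < n) x ord0 i * y ord0 i <= enorm x * enorm y.
Proof.
have [->|/enorm_gt0 x0] := eqVneq x 0.
  by rewrite big1 ?mulr_ge0 ?enorm_ge0// => i _; rewrite mxE mul0r.
have [->|/enorm_gt0 y0] := eqVneq y 0.
  by rewrite big1 ?mulr_ge0 ?enorm_ge0// => i _; rewrite mxE mulr0.
(* Weighted AM-GM in each coordinate: with these weights, each of the two terms sums to half of
   [enorm x * enorm y], which gives Cauchy-Schwarz. *)
have xi i : x ord0 i * y ord0 i <=
    enorm y / enorm x / 2 * x ord0 i ^+ 2 + enorm x / enorm y / 2 * y ord0 i ^+ 2.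
  rewrite -subr_ge0.
  rewrite (_ : _ - _ = (enorm y * x ord0 i - enorm x * y ord0 i) ^+ 2
    / (2 * enorm x * enorm y)); last by field; rewrite !gt_eqF.
  by rewrite divr_ge0 ?sqr_ge0// !mulr_ge0// enorm_ge0.
apply: le_trans (ler_sum _ (fun i _ => xi i)) _.
rewrite big_split/= -!mulr_sumr -!sqr_enorm le_eqVlt; apply/orP; left; apply/eqP.
by field; rewrite !gt_eqF.
Qed.

Lemma ler_enormD x y : enorm (x + y) <= enorm x + enorm y.
Proof.
rewrite -(@ler_pXn2r _ 2)// ?nnegrE ?addr_ge0 ?enorm_ge0//.
rewrite sqrrD !sqr_enorm.
under eq_bigr do rewrite mxE sqrrD.
by rewrite !big_split/= lerD2r lerD2l mulr2n lerD// dot_le_enorm.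
Qed.

Lemma ler_enormB x y : enorm (x - y) <= enorm x + enorm y.
Proof. by rewrite (le_trans (ler_enormD _ _))// enormN. Qed.

Lemma lerB_enorm x y : enorm x - enorm y <= enorm (x - y).
Proof. by rewrite lerBlDr (le_trans _ (ler_enormD _ _))// subrK. Qed.

Lemma enorm_lt_coord x (e : R) : 0 < e ->
  (forall i, `|x ord0 i| <= e / n.+1%:R) -> enorm x < e.
Proof.
move=> e0 xe; rewrite -(@ltr_pXn2r _ 2)// ?nnegrE ?enorm_ge0 ?(ltW e0)// sqr_enorm.
apply: (@le_lt_trans _ _ (\sum_(i < n) (e / n.+1%:R) ^+ 2)).
  apply: ler_sum => i _; rewrite -real_normK ?num_real//.
  by rewrite ler_pXn2r ?nnegrE ?divr_ge0 ?(ltW e0).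
(* The sum is n e^2 / (n+1)^2; dividing by n+1 rather than n makes the bound strict, since n <
   (n+1)^2, and covers n = 0. *)
rewrite sumr_const card_ord exprMn -[_ *+ n]mulr_natr -mulrA gtr_pMr ?exprn_gt0// exprVn.
rewrite mulrC ltr_pdivrMr ?exprn_gt0// mul1r -natrX ltr_nat.
by rewrite expnS expn1 mulSn ltnS (leq_trans _ (leq_addr _ _)).
Qed.

Lemma measurable_enorm : measurable_fun setT (@enorm R n : Rn R n -> R).
Proof.
apply: (measurableT_comp (f := @Num.sqrt R)).
  exact: continuous_measurable_fun (@sqrt_continuous R).
apply: measurable_sum => i; apply: measurable_funX; exact: measurable_coord.
Qed.

Definition oball (r : R) : set (Rn R n) := [set x | enorm (x : 'rV[R]_n) < r].

Lemma measurable_oball r : measurable (oball r).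
Proof.
have -> : oball r = [set: Rn R n] `&` (@enorm R n : Rn R n -> R) @^-1` `]-oo, r[.
  by rewrite setTI; apply/seteqP; split => x; rewrite /oball/= in_itv.
exact: measurable_enorm.
Qed.

Lemma measurable_scale (t : R) :
  measurable_fun setT (fun x : Rn R n => t *: (x : 'rV[R]_n) : Rn R n).
Proof.
apply: measurable_fun_Rn => i; under eq_fun do rewrite mxE.
by apply: measurable_funM => //; exact: measurable_coord.
Qed.

End EuclideanNorm.

(** * Lebesgue measure: scaling, balls and points *)

Section Lebesgue.
Context {R : realType} {n : nat} (lam : {measure set Rn R n -> \bar R}).
Hypothesis lamE : is_lebesgue lam.

Lemma lebesgue_hbox (a b : 'rV[R]_n) : (forall i, a ord0 i <= b ord0 i) ->
  lam (hbox a b) = (\prod_(i < n) (b ord0 i - a ord0 i))%:E.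
Proof. exact: lamE. Qed.

Let cube (k : nat) : set (Rn R n) := hbox (const_mx (- k%:R)) (const_mx k%:R).

Let cubeP k : hboxes (cube k).
Proof.
by exists (const_mx (- k%:R), const_mx k%:R) => //= i; rewrite !mxE ge0_cp.
Qed.

Let cube_cover : \bigcup_k cube k = setT.
Proof.
apply/seteqP; split => // x _; exists (Num.truncn (enorm (x : 'rV_n))).+1 => //= i.
rewrite !mxE; have xk := truncnS_gt (enorm (x : 'rV_n)).
have := le_lt_trans (ler_coord_enorm (x : 'rV_n) i) xk.
by rewrite ltr_norml => /andP[-> /ltW ->].
Qed.

Let cube_lty k : (lam (cube k) < +oo)%E.
Proof. by rewrite lebesgue_hbox ?ltry// => i; rewrite !mxE ge0_cp. Qed.

Lemma lebesgue_sigma_finite : sigma_finite setT lam.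
Proof.
exists cube; first by rewrite cube_cover.
by move=> k; split; [exact: hbox_measurable|exact: cube_lty].
Qed.

(** Both sides are measures in [A] that agree on boxes. Boxes are stable under intersection and
    generate the Borel sets, and the cubes exhaust the space with finite measure, so the two
    measures coincide. *)
Lemma lebesgue_scale (s : R) (A : set (Rn R n)) : 0 < s -> measurable A ->
  lam ((fun x : Rn R n => s^-1 *: (x : 'rV[R]_n) : Rn R n) @^-1` A)
  = ((s ^+ n)%:E * lam A)%E.
Proof.
move=> s0 mA.
have sn0 : 0 <= s ^+ n by rewrite exprn_ge0 ?ltW.
pose f := (fun x : Rn R n => s^-1 *: (x : 'rV[R]_n) : Rn R n).
have mf : measurable_fun setT f by exact: measurable_scale.
apply/esym.
apply: (measure_unique hboxes cube measurable_hboxesE hboxes_setI_closed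
  cubeP cube_cover (mscale (NngNum sn0) lam) (pushforward lam f)) => //.
- move=> _ [[a b] /= ab <-]; rewrite /mscale/= /pushforward.
  rewrite lebesgue_hbox// (_ : f @^-1` _ = hbox (s *: a) (s *: b)).
    have sab i : (s *: a) ord0 i <= (s *: b) ord0 i by rewrite !mxE ler_pM2l.
    apply: etrans (esym (lebesgue_hbox _ _ sab)).
    rewrite -EFinM; congr EFin; under [RHS]eq_bigr do rewrite !mxE -mulrBr.
    by rewrite big_split/= prodr_const card_ord.
  by apply/seteqP; split => x xab i; move: (xab i); rewrite /f /= !mxE
    (mulrC s^-1) ltr_pdivlMr// ler_pdivrMr// !(mulrC s).
- by move=> k; apply: lte_mul_pinfty => //; exact: cube_lty.
Qed.

Lemma lebesgue_oball (r : R) : 0 < r ->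
  lam (oball r) = ((r ^+ n)%:E * lam (oball 1))%E.
Proof.
move=> r0; rewrite -lebesgue_scale//; last exact: measurable_oball.
congr (lam _); apply/seteqP; split => x;
  by rewrite /oball/= enormZ gtr0_norm ?invr_gt0// mulrC ltr_pdivrMr// mul1r.
Qed.

(** The unit ball lies between the cubes of half-sides 1/(n+1) and 1, up to boundary, so its measure
    is positive and finite. *)
Lemma lebesgue_oball1 : exists2 w : R, 0 < w & lam (oball 1) = w%:E.
Proof.
have lty : (lam (oball 1) < +oo)%E.
  apply: le_lt_trans (cube_lty 1); apply: le_measure; rewrite ?inE.
  - exact: measurable_oball.
  - exact: hbox_measurable.
  move=> x /= x1 i; rewrite !mxE.
  have := le_lt_trans (ler_coord_enorm (x : 'rV_n) i) x1.
  by rewrite ltr_norml => /andP[-> /ltW ->].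
have gt0 : (0 < lam (oball 1))%E.
  have n0 : 0 < n.+1%:R^-1 :> R by rewrite invr_gt0.
  pose B : set (Rn R n) := hbox (const_mx (- n.+1%:R^-1)) (const_mx n.+1%:R^-1).
  apply: (@lt_le_trans _ _ (lam B)).
    rewrite lebesgue_hbox; last by move=> i; rewrite !mxE ge0_cp// ltW.
    by rewrite lte_fin prodr_gt0// => i _; rewrite !mxE opprK addr_gt0.
  apply: le_measure; rewrite ?inE; [exact: hbox_measurable|exact: measurable_oball|].
  move=> x xB; apply: enorm_lt_coord => // i; have := xB i; rewrite !mxE => /andP[h1 h2].
  by rewrite mul1r ler_norml h2 (ltW h1).
have fin : lam (oball 1) \is a fin_num by rewrite ge0_fin_numE ?measure_ge0.
exists (fine (lam (oball 1))); last by rewrite fineK.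
by rewrite fine_gt0// gt0.
Qed.

Lemma measurable_point (x : Rn R n) : measurable [set x].
Proof.
have -> : [set x] = \bigcap_k
   hbox ((x : 'rV[R]_n) - const_mx k.+1%:R^-1) x.
  apply/seteqP; split => [_ -> k _ i|y yx].
    by rewrite !mxE lexx andbT ltrBlDr ltrDl invr_gt0.
  apply/rowP => i; apply/eqP; rewrite eq_le; apply/andP; split.
    by have /(_ i)/andP[] := yx 0 I.
  apply/ler_addgt0Pr => e e0; rewrite -lerBlDr.
  (* This index k satisfies 1/(k+1) < e. *)
  have := yx (Num.truncn e^-1) I i; rewrite !mxE => /andP[/ltW h _].
  apply: le_trans h; rewrite lerD2l lerN2 -[leRHS]invrK lef_pV2 ?posrE ?invr_gt0//.
  by rewrite ltW// truncnS_gt.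
by apply: bigcapT_measurable => k; exact: hbox_measurable.
Qed.

Lemma lebesgue_point (x : Rn R n) : (0 < n)%N -> lam [set x] = 0%E.
Proof.
move=> n0; apply/eqP; rewrite eq_le measure_ge0 andbT.
apply/lee_addgt0Pr => e e0; rewrite add0e.
(* Capping the side at 1 gives d^n <= d <= e, because n >= 1. *)
pose d : R := Num.min e 1; have d0 : 0 < d by rewrite lt_min e0 ltr01.
apply: (@le_trans _ _ (lam (hbox ((x : 'rV[R]_n) - const_mx d) x))).
  apply: le_measure; rewrite ?inE; [exact: measurable_point|exact: hbox_measurable|].
  by move=> _ -> i; rewrite !mxE lexx andbT ltrBlDr ltrDl.
rewrite lebesgue_hbox => [|i]; last by rewrite !mxE gerBl ltW.
under eq_bigr do rewrite !mxE opprB addrC subrK.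
rewrite prodr_const card_ord lee_fin.
apply: (@le_trans _ _ d); last by rewrite /d ge_min lexx.
rewrite -[leRHS]expr1; apply: ler_wiXn2l => //; first exact: ltW.
by rewrite /d ge_min lexx orbT.
Qed.

End Lebesgue.

(** * Bundled finite and sigma-finite measures *)

Section MeasurePacking.
Context d (T : measurableType d) (R : realType) (mu : {measure set T -> \bar R}).

Lemma finite_measure_pack : (mu setT < +oo)%E ->
  exists m : {finite_measure set T -> \bar R}, m = mu :> (set T -> \bar R).
Proof.
move=> muT; exists (mfrestr measurableT muT).
by apply/funext => A; exact: congr1 (setIT A).
Qed.

(** A copy of [mu] that carries a proof of sigma-finiteness as an argument, so that the sigma-finite
    structure can be attached to it. *)
Definition msigma_finite & sigma_finite setT mu := (mu : set T -> \bar R).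

HB.instance Definition _ h := Measure.on (msigma_finite h).

HB.instance Definition _ h := Measure_isSigmaFinite.Build _ _ _ (msigma_finite h) h.

Lemma sigma_finite_measure_pack : sigma_finite setT mu ->
  exists m : {sigma_finite_measure set T -> \bar R}, m = mu :> (set T -> \bar R).
Proof. by move=> h; exists (msigma_finite h). Qed.

End MeasurePacking.

(** * Radially decreasing kernels and pointwise bounds on their convolutions *)

Section RadialDecreasing.
Context {R : realType} {n : nat} (g : Rn R n -> R).
Hypothesis gdec : pos_radial_decreasing g.

Lemma radial_gt0 x : 0 < g x. Proof. by case: gdec. Qed.

Lemma radial_le (x y : Rn R n) : x != 0 :> 'rV[R]_n ->
  enorm (x : 'rV[R]_n) <= enorm (y : 'rV[R]_n) -> g y <= g x.
Proof.
move=> x0 xy; have [_ [phi [phi_dec gE]]] := gdec.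
have y0 : y != 0 :> 'rV[R]_n.
  apply: contraTneq xy => ->; rewrite -ltNge.
  by rewrite [enorm 0](_ : _ = 0) ?enorm_gt0// -(scale0r 0) enormZ normr0 mul0r.
by rewrite !gE// phi_dec// enorm_gt0.
Qed.

(** A superlevel set of the profile on the positive half-line is an interval. Its preimage under the
    norm is a superlevel set of [g] away from the origin, and the origin is added according to the
    value [g 0]. *)
Lemma measurable_radial : measurable_fun setT g.
Proof.
have [_ [phi [phi_dec gE]]] := gdec.
apply: (measurability (@RGenOInfty.G R)).
  exact: RGenOInfty.measurableE.
move=> _ [_ [c ->] <-]; rewrite setTI.
pose I : set R := [set s | 0 < s /\ c < phi s].
have mI : measurable I.
  apply: is_interval_measurable => s u [s0 _] [_ cu] z /andP[sz zu].
  by split; [exact: lt_le_trans s0 sz|rewrite (lt_le_trans cu)// phi_dec// (lt_le_trans s0)].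
have -> : g @^-1` `]c, +oo[ =
    ((@enorm R n : Rn R n -> R) @^-1` I) `|` ([set 0 : 'rV[R]_n] `&` [set _ | c < g 0]).
  apply/seteqP; split => x; rewrite /= in_itv/= andbT.
    have [->|x0] := eqVneq (x : 'rV[R]_n) 0; first by right.
    by rewrite gE// => cx; left; split => //; exact: enorm_gt0.
  case=> [[ex cx]|[->//]]; rewrite gE//; apply: contraTneq ex => ->.
  by rewrite -leNgt [enorm 0](_ : _ = 0)// -(scale0r 0) enormZ normr0 mul0r.
apply: measurableU.
  by rewrite -[X in measurable X]setTI; exact: measurable_enorm.
have [cg|cg] := pselect (c < g 0).
  rewrite (_ : [set _ | _] = setT); last by apply/seteqP; split.
  by rewrite setIT; exact: measurable_point.
by rewrite (_ : [set _ | _] = set0) ?setI0//; apply/seteqP; split.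
Qed.

Lemma measurable_radial_sub (x : Rn R n) : measurable_fun setT
  (fun y : Rn R n => g ((x : 'rV[R]_n) - (y : 'rV[R]_n))).
Proof.
apply: (measurableT_comp measurable_radial); apply: measurable_fun_Rn => i.
under eq_fun do rewrite !mxE.
by apply: measurable_funD => //; apply: measurable_funN; exact: measurable_coord.
Qed.

Lemma measurable_Tg_meas (m : {sigma_finite_measure set Rn R n -> \bar R}) :
  measurable_fun setT (Tg_meas g m).
Proof.
apply: (measurable_fun_fubini_tonelli_F (m2 := m)
  (fun z : Rn R n * Rn R n => (g ((z.1 : 'rV[R]_n) - (z.2 : 'rV[R]_n)))%:E)) => /=.
  apply/measurable_EFinP; apply: (measurableT_comp measurable_radial).
  apply: measurable_fun_Rn => i; under eq_fun do rewrite !mxE.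
  apply: measurable_funD; last apply: measurable_funN.
    exact: (measurableT_comp (measurable_coord i) measurable_fst).
  exact: (measurableT_comp (measurable_coord i) measurable_snd).
by move=> z; rewrite lee_fin ltW// radial_gt0.
Qed.

Lemma Tg_meas_ge0 (m : {measure set Rn R n -> \bar R}) x : (0 <= Tg_meas g m x)%E.
Proof. by apply: integral_ge0 => y _; rewrite lee_fin ltW// radial_gt0. Qed.

Lemma measurable_Tg_meas_gt (m : {sigma_finite_measure set Rn R n -> \bar R}) (l : R) :
  measurable [set x | (l%:E < `|Tg_meas g m x|)%E].
Proof.
rewrite -[X in measurable X]setTI; apply: emeasurable_fun_o_infty => //.
by apply: measurableT_comp => //; exact: measurable_Tg_meas.
Qed.

(** For |x| < rho - k and |y| < k the difference x - y has norm below rho, so the kernel is at least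
    c there unless y = x. Since [g 0] may be small, the point [x] has to be null for [m]. *)
Lemma Tg_meas_lower (m : {measure set Rn R n -> \bar R}) (c rho k : R) x :
  0 <= c -> (forall z : Rn R n, z != 0 :> 'rV[R]_n -> enorm (z : 'rV[R]_n) < rho -> c <= g z) ->
  m [set x] = 0%E -> enorm (x : 'rV[R]_n) < rho - k ->
  (c%:E * m (oball k) <= Tg_meas g m x)%E.
Proof.
move=> c0 cg mx0 xrho.
have mB := @measurable_oball R n k.
have mG : measurable_fun setT (fun y : Rn R n => (g ((x : 'rV[R]_n) - (y : 'rV[R]_n)))%:E).
  by apply/measurable_EFinP; exact: measurable_radial_sub.
have G0 y : (0 <= (g ((x : 'rV[R]_n) - (y : 'rV[R]_n)))%:E)%E.
  by rewrite lee_fin ltW// radial_gt0.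
apply: (@le_trans _ _ (\int[m]_(y in oball k) (g ((x : 'rV[R]_n) - (y : 'rV[R]_n)))%:E)%E);
  last by apply: ge0_subset_integral.
rewrite -integral_cst//; apply: ae_ge0_le_integral => //.
  exact: measurable_funTS.
exists [set x]; split => //; first exact: measurable_point.
move=> y /= /not_implyP[yk cgxy]; apply: contrapT => yx; apply: cgxy.
rewrite lee_fin cg ?subr_eq0//; first by apply/eqP => xy; apply: yx.
by rewrite (le_lt_trans (ler_enormB _ _))// -ltrBrDr (lt_le_trans xrho)// lerD2l lerN2 ltW.
Qed.

(** For |x| >= rho + k and |y| < k the difference x - y has norm at least rho, so the integrand is
    at most c. *)
Lemma Tg_meas_upper (m : {measure set Rn R n -> \bar R}) (c rho k : R) x :
  0 <= c -> (forall z : Rn R n, rho <= enorm (z : 'rV[R]_n) -> g z <= c) ->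
  rho + k <= enorm (x : 'rV[R]_n) ->
  (\int[m]_(y in oball k) (g ((x : 'rV[R]_n) - (y : 'rV[R]_n)))%:E <= c%:E * m setT)%E.
Proof.
move=> c0 gc xrho.
have mB := @measurable_oball R n k.
apply: (@le_trans _ _ (c%:E * m (oball k))%E); last first.
  by rewrite lee_wpmul2l ?lee_fin// le_measure ?inE.
rewrite -integral_cst//; apply: ge0_le_integral => //.
- by move=> y _; rewrite lee_fin ltW// radial_gt0.
- by apply/measurable_EFinP; apply: measurable_funTS; exact: measurable_radial_sub.
- move=> y yk; rewrite lee_fin gc// (le_trans _ (lerB_enorm _ _))//.
  by rewrite lerBrDr (le_trans _ xrho)// lerD2l ltW.
Qed.

End RadialDecreasing.

(** * From the weak type bound on functions to measures *)

Section WeakType.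
Context {R : realType} {n : nat} (lam : {measure set Rn R n -> \bar R})
  (g : Rn R n -> R).
Hypotheses (gdec : pos_radial_decreasing g) (sfin : sigma_finite setT lam).
Local Open Scope ereal_scope.

Lemma weak_norm_ge (r : R) (F : Rn R n -> \bar R) (l : R) : (0 < l)%R ->
  l%:E * (lam [set x | l%:E < `|F x|]) `^ r^-1 <= weak_norm lam r F.
Proof. by move=> l0; apply: ereal_sup_ubound; exists l. Qed.

(** If f is the Radon-Nikodym density of [m], then T_g m = T_g f and the L^1 norm of f is the total
    mass of [m], so the operator bound applied to f is the claim. *)
Lemma weak_type_measure (m : {finite_measure set Rn R n -> \bar R}) (r A l : R) :
  m `<< lam ->
  (forall f : Rn R n -> R, lam.-integrable setT (EFin \o f) ->
     weak_norm lam r (Tg_fun lam g f) <= A%:E * L1_norm lam f) ->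
  (0 < l)%R ->
  l%:E * (lam [set x | l%:E < `|Tg_meas g m x|]) `^ r^-1 <= A%:E * m setT.
Proof.
move=> mlam bound l0.
have [mu muE] := sigma_finite_measure_pack _ _ _ _ sfin.
have mmu : m `<< mu by rewrite muE.
pose h := Radon_Nikodym_SigmaFinite.f m mu.
have h0 x : 0 <= h x by exact: Radon_Nikodym_SigmaFinite.f_ge0.
(* The chosen density is finite everywhere, so passing to real values changes nothing. *)
pose f := fine \o h.
have fE : EFin \o f = h.
  by apply/funext => x /=; rewrite fineK// Radon_Nikodym_SigmaFinite.f_fin_num.
have fint : lam.-integrable setT (EFin \o f).
  by rewrite -muE fE; exact: Radon_Nikodym_SigmaFinite.f_integrable.
have -> : Tg_meas g m = Tg_fun lam g f.
  apply/funext => x; rewrite /Tg_meas /Tg_fun.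
  under [RHS]eq_integral do rewrite EFinM -[(f _)%:E]/((EFin \o f) _) fE.
  rewrite -muE; apply/esym/Radon_Nikodym_SigmaFinite.change_of_variables => //.
    by move=> y; rewrite lee_fin ltW// (radial_gt0 _ gdec).
  by apply/measurable_EFinP; exact: measurable_radial_sub.
have -> : m setT = L1_norm lam f.
  rewrite /L1_norm -muE.
  under eq_integral do rewrite -[(f _)%:E]/((EFin \o f) _) fE gee0_abs//.
  exact: Radon_Nikodym_SigmaFinite.f_integral.
exact: le_trans (weak_norm_ge _ _ _ l0) (bound _ fint).
Qed.

End WeakType.

(** * Limits inferior and superior from eventual bounds *)

Section LimitBounds.
Context {T : choiceType} {X : filteredType T} {R : realType}.
Local Open Scope ereal_scope.

Lemma limf_einf_ge (f : X -> \bar R) (F : set_system X) (a : \bar R) :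
  (\forall t \near F, a <= f t) -> a <= limf_einf f F.
Proof.
move=> Fa; rewrite limf_einfE; apply: le_ereal_sup_tmp.
exists (ereal_inf (f @` [set t | a <= f t])); first by exists [set t | a <= f t].
by apply/ereal_infP => _ [t /= at_ <-].
Qed.

Lemma limf_esup_le (f : X -> \bar R) (F : set_system X) (a : \bar R) :
  (\forall t \near F, f t <= a) -> limf_esup f F <= a.
Proof.
move=> Fa; rewrite limf_esupE; apply: ge_ereal_inf.
exists (ereal_sup (f @` [set t | f t <= a])); first by exists [set t | f t <= a].
by apply/ereal_supP => _ [t /= at_ <-].
Qed.

End LimitBounds.

(** * Powers of extended reals *)

Section ExtendedReals.
Context {R : realType}.
Local Open Scope ereal_scope.

Lemma poweRK (x : \bar R) (r : R) : 0 <= x -> (r != 0)%R -> (x `^ r) `^ r^-1 = x.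
Proof. by move=> x0 r0; rewrite -poweRrM divff// poweRe1. Qed.

Lemma le_poweR2r (x y : \bar R) (r : R) : (0 < r)%R -> 0 <= x -> 0 <= y ->
  (x `^ r <= y `^ r) = (x <= y).
Proof.
have mono (u v : \bar R) s : (0 < s)%R -> 0 <= u -> 0 <= v -> u <= v -> u `^ s <= v `^ s.
  move=> s0 u0 v0; apply: gt0_ler_poweR => //; first exact: ltW.
    by rewrite in_itv/= u0 leey.
  by rewrite in_itv/= v0 leey.
move=> r0 x0 y0; apply/idP/idP; last exact: mono.
move=> /(mono _ _ r^-1%R); rewrite !poweRK ?gt_eqF// invr_gt0.
by apply => //; exact: poweR_ge0.
Qed.

End ExtendedReals.

(** * Measures of balls *)

Section Balls.
Context {R : realType} {n : nat} (lam : {measure set Rn R n -> \bar R}).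
Hypotheses (n0 : (0 < n)%N) (lamE : is_lebesgue lam).
Local Open Scope ereal_scope.

Lemma lebesgue_oball_lty (s : R) : lam (oball s) < +oo.
Proof.
have [w w0 wE] := lebesgue_oball1 _ lamE.
have [s0|s0] := ltP 0%R s; first by rewrite lebesgue_oball// wE -EFinM ltry.
rewrite (_ : oball s = set0) ?measure0//; apply/seteqP; split => // x.
by rewrite /oball/= => xs; have := le_lt_trans (enorm_ge0 x) (lt_le_trans xs s0); rewrite ltxx.
Qed.

Lemma le_lebesgue_oball (s u : R) : (s <= u)%R -> lam (oball s) <= lam (oball u).
Proof.
move=> su; apply: le_measure; rewrite ?inE; try exact: measurable_oball.
by move=> x; rewrite /oball/= => xs; exact: lt_le_trans su.
Qed.

(** Choose a real c strictly between the two bounds and solve s^n w = c, where w is the measure of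
    the unit ball. *)
Lemma lebesgue_oball_between (a b : \bar R) : 0 <= a -> a < b ->
  exists2 s : R, (0 < s)%R & a < lam (oball s) < b.
Proof.
move=> a0 ab; have [w w0 wE] := lebesgue_oball1 _ lamE.
have [c ac cb] : exists2 c : R, a < c%:E & c%:E < b.
  case: a a0 ab => [a||]//= _; case: b => [b||]//=.
    by rewrite lte_fin => ab; exists ((a + b) / 2)%R; rewrite lte_fin; lra.
  by move=> _; exists (a + 1)%R; rewrite ?ltry// lte_fin ltrDl.
have c0 : (0 < c)%R by rewrite -lte_fin (le_lt_trans a0).
pose s := ((c / w) `^ n%:R^-1)%R.
have s0 : (0 < s)%R by rewrite powR_gt0// divr_gt0.
exists s => //; rewrite lebesgue_oball// wE -powR_mulrn ?ltW// -powRrM mulVf ?pnatr_eq0 -?lt0n//.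
by rewrite powRr1 ?divr_ge0 ?ltW// -EFinM divfK ?gt_eqF// ac cb.
Qed.

End Balls.

(** * Distribution function of T_g m compared with balls *)

Section Distribution.
Context {R : realType} {n : nat} (lam : {measure set Rn R n -> \bar R})
  (g : Rn R n -> R).
Hypotheses (n0 : (0 < n)%N) (lamE : is_lebesgue lam) (gdec : pos_radial_decreasing g).
Local Open Scope ereal_scope.

Let lebesgue_point_dominated (m : {measure set Rn R n -> \bar R}) x :
  m `<< lam -> m [set x] = 0.
Proof.
move=> /null_content_dominatesP; apply; first exact: measurable_point.
exact: lebesgue_point.
Qed.

(** The whole ball of radius s lies in the superlevel set: there T_g m is at least c times the mass
    of [m] in the ball of radius u - s. Absolute continuity makes single points null. *)
Lemma distribution_lower (m : {finite_measure set Rn R n -> \bar R}) (c s u l : R) :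
  m `<< lam -> (0 <= c)%R ->
  (forall z : Rn R n, z != 0%R :> 'rV[R]_n -> (enorm (z : 'rV[R]_n) < u)%R -> (c <= g z)%R) ->
  l%:E < c%:E * m (oball (u - s)) ->
  lam (oball s) <= lam [set x | l%:E < `|Tg_meas g m x|].
Proof.
move=> mlam c0 cg lcm; apply: le_measure; rewrite ?inE.
- exact: measurable_oball.
- exact: measurable_Tg_meas_gt.
move=> x xs /=; rewrite gee0_abs ?Tg_meas_ge0//.
apply: (lt_le_trans lcm); apply: (Tg_meas_lower _ gdec _ _ u) => //.
  exact: lebesgue_point_dominated.
by rewrite subKr.
Qed.

(** Here [m'] is the part of [m] off the ball of radius u - s. At a point outside the ball of radius
    u, the inner part contributes at most c times the total mass, so exceeding [l] forces T_g m' to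
    exceed [e]. *)
Lemma distribution_upper (m m' : {finite_measure set Rn R n -> \bar R}) (c s u l e : R) :
  (0 <= c)%R -> m' = mrestr m (measurableC (measurable_oball (u - s))) :> (set _ -> \bar R) ->
  (forall z : Rn R n, (s <= enorm (z : 'rV[R]_n))%R -> (g z <= c)%R) ->
  c%:E * m setT + e%:E <= l%:E ->
  lam [set x | l%:E < `|Tg_meas g m x|] <=
    lam (oball u) + lam [set x | e%:E < `|Tg_meas g m' x|].
Proof.
move=> c0 m'E gc ce.
have mT := measurable_Tg_meas_gt g gdec.
have mB := @measurable_oball R n.
apply: (@le_trans _ _ (lam (oball u `|` [set x | e%:E < `|Tg_meas g m' x|]))); last first.
  exact: measureU2.
apply: le_measure; rewrite ?inE; [exact: mT|exact: measurableU|].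
move=> x /= lx; have [xu|ux] := ltP (enorm (x : 'rV[R]_n)) u; [by left|right].
rewrite /= gee0_abs ?Tg_meas_ge0// ltNge; apply/negP => Txe.
move: lx; rewrite gee0_abs ?Tg_meas_ge0// ltNge => /negP; apply.
apply: le_trans ce.
have mG : measurable_fun setT (fun y : Rn R n => (g ((x : 'rV[R]_n) - (y : 'rV[R]_n)))%:E).
  by apply/measurable_EFinP; exact: measurable_radial_sub.
rewrite /Tg_meas -[in leLHS](setUv (oball (u - s))) ge0_integral_setU//.
- apply: leeD.
    apply: (Tg_meas_upper _ gdec _ _ s) => //.
    by rewrite addrC subrK.
  apply: le_trans Txe.
  rewrite (@eq_measure_integral _ _ _ (~` oball (u - s)) m'); last first.
    move=> B mB' BD; apply: etrans (esym (congr1 (fun mu => mu B) m'E)).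
    by apply: (congr1 m); apply/seteqP; split => [y By|y []//]; split => //; exact: BD.
  by apply: ge0_subset_integral => //; [exact: measurableC|move=> y _; rewrite lee_fin ltW// radial_gt0].
- exact: measurableC.
- by rewrite setUv.
- by move=> y _; rewrite lee_fin ltW// radial_gt0.
- exact/disj_set2P/setICr.
Qed.

End Distribution.

(** * Level sets of g against balls, and the weak norm bound *)

Section Dilation.
Context {R : realType} {n : nat} (lam V : {measure set Rn R n -> \bar R})
  (g : Rn R n -> R).
Hypotheses (n0 : (0 < n)%N) (lamE : is_lebesgue lam) (gdec : pos_radial_decreasing g).
Local Open Scope ereal_scope.

Let measurable_g_ge (l v : R) : measurable [set x | l%:E <= `|(g x)%:E * v%:E|].
Proof.
rewrite -[X in measurable X]setTI; apply: emeasurable_fun_c_infty => //.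
apply: measurableT_comp => //; apply: emeasurable_funM => //.
by apply/measurable_EFinP; exact: measurable_radial.
Qed.

Let measurable_g_gt (l v : R) : measurable [set x | l%:E < `|(g x)%:E * v%:E|].
Proof.
rewrite -[X in measurable X]setTI; apply: emeasurable_fun_o_infty => //.
apply: measurableT_comp => //; apply: emeasurable_funM => //.
by apply/measurable_EFinP; exact: measurable_radial.
Qed.

Let g_gtE (l v : R) : (0 <= v)%R ->
  [set x | l%:E < `|(g x)%:E * v%:E|] = [set x | (l < g x * v)%R].
Proof.
move=> v0; apply/seteqP; split => x; rewrite /mkset -EFinM gee0_abs ?lte_fin//;
  by rewrite lee_fin mulr_ge0// ltW// radial_gt0.
Qed.

Let g_geE (l v : R) : (0 <= v)%R ->
  [set x | l%:E <= `|(g x)%:E * v%:E|] = [set x | (l <= g x * v)%R].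
Proof.
move=> v0; apply/seteqP; split => x; rewrite /mkset -EFinM gee0_abs ?lee_fin//;
  by rewrite mulr_ge0// ltW// radial_gt0.
Qed.

(** The level set is too large to fit in the ball, so it has a point x0 outside, and c = g x0 works
    by monotonicity. *)
Lemma level_exceeds_ball (l v s : R) : (0 <= v)%R ->
  lam (oball s) < lam [set x | l%:E < `|(g x)%:E * v%:E|] ->
  exists c : R, [/\ (0 < c)%R, (l < c * v)%R & forall z : Rn R n,
    z != 0%R :> 'rV[R]_n -> (enorm (z : 'rV[R]_n) < s)%R -> (c <= g z)%R].
Proof.
move=> v0 sl.
have [x0 [lx0 x0s]] : exists x, (l < g x * v)%R /\ (s <= enorm (x : 'rV[R]_n))%R.
  apply: contrapT => /forallNP h; move: sl; rewrite ltNge => /negP; apply.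
  apply: le_measure; rewrite ?inE//; first exact: measurable_oball.
  rewrite g_gtE// => x /= lx; rewrite /oball /= ltNge.
  by apply/negP => sx; apply: (h x).
exists (g x0); split => //; first exact: radial_gt0.
by move=> z z0 zs; apply: radial_le => //; rewrite (le_trans (ltW zs)).
Qed.

(** The ball is too large to fit in the level set, even after removing the null origin, where [g]
    need not be monotone. A remaining point z0 off the level set gives c = g z0. *)
Lemma ball_exceeds_level (l v s : R) : (0 <= v)%R ->
  lam [set x | l%:E <= `|(g x)%:E * v%:E|] < lam (oball s) ->
  exists c : R, [/\ (0 < c)%R, (c * v < l)%R & forall z : Rn R n,
    (s <= enorm (z : 'rV[R]_n))%R -> (g z <= c)%R].
Proof.
move=> v0 ls.
have mD : measurable (oball s `\` [set 0%R : Rn R n]).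
  by apply: measurableD; [exact: measurable_oball|exact: measurable_point].
have [z0 [z0s z00 lz0]] : exists z : Rn R n,
    [/\ (enorm (z : 'rV[R]_n) < s)%R, z != 0%R :> 'rV[R]_n & (g z * v < l)%R].
  apply: contrapT => /forallNP h; move: ls; rewrite ltNge => /negP; apply.
  apply: (@le_trans _ _ (lam ((oball s `\` [set 0%R]) `|` [set 0%R]))).
    apply: le_measure; rewrite ?inE; [exact: measurable_oball| |].
      by apply: measurableU => //; exact: measurable_point.
    by move=> x xs; have [->|x0] := pselect (x = 0%R); [right|left].
  apply: (le_trans (measureU2 _ mD (measurable_point _))).
  rewrite [X in _ + X](lebesgue_point _ lamE)// adde0.
  apply: le_measure; rewrite ?inE//.
  rewrite g_geE// => x [xs /eqP x0] /=; rewrite leNgt; apply/negP => xl; exact: (h x).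
exists (g z0); split => //; first exact: radial_gt0.
by move=> z zs; apply: radial_le => //; rewrite (le_trans (ltW z0s)).
Qed.

Lemma weak_norm_le_opnorm (r : R) : (0 < r)%R ->
  weak_norm lam r (EFin \o g) <= Tg_opnorm lam r g.
Proof.
move=> r0; apply/ereal_infP => _ [A [A0 bound] <-].
apply/ereal_supP => _ [l /= l0 <-].
have sfin := lebesgue_sigma_finite _ lamE.
rewrite leNgt; apply/negP => Al.
(* The critical measure, for which l a^(1/r) = A. If the bound fails, the level set has measure
   above a. *)
pose a : \bar R := (A / l)%:E `^ r.
have a0 : 0 <= a by exact: poweR_ge0.
have aK : a `^ r^-1 = (A / l)%:E by rewrite poweRK ?gt_eqF// lee_fin divr_ge0// ltW.
(* The factor 1 puts the level set in the form of [level_exceeds_ball] with v = 1. *)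
pose S := [set x | l%:E < `|(g x)%:E * 1%:E|].
have SE : [set x | l%:E < `|(EFin \o g) x|] = S.
  by apply/seteqP; split => x; rewrite /S /mkset mule1.
have aS : a < lam S.
  rewrite ltNge; apply/negP => Sa; move: Al; rewrite ltNge => /negP; apply.
  rewrite SE (@le_trans _ _ (l%:E * a `^ r^-1))//.
    by rewrite lee_pmul2l ?lte_fin// le_poweR2r ?invr_gt0.
  by rewrite aK -EFinM mulrC divfK// gt_eqF.
have [s2 s20 /andP[as2 s2S]] := lebesgue_oball_between _ n0 lamE _ _ a0 aS.
have [s1 s10 /andP[as1 s12]] := lebesgue_oball_between _ n0 lamE _ _ a0 as2.
have ds : (0 < s2 - s1)%R.
  rewrite subr_gt0 ltNge; apply/negP => s21.
  by move: s12; rewrite ltNge le_lebesgue_oball.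
have mB := @measurable_oball R n (s2 - s1).
(* The test measure is Lebesgue measure on the ball of radius s2 - s1, of mass q. It gives T_g m > l
   q on the ball of radius s1; the weak type bound then cancels q and forces the measure of that
   ball to be at most a, a contradiction. *)
pose m : {finite_measure set Rn R n -> \bar R} :=
  mfrestr mB (lebesgue_oball_lty _ lamE (s2 - s1)).
have mlam : m `<< lam.
  apply/null_content_dominatesP => B mB0 B0; apply/eqP.
  rewrite eq_le measure_ge0 andbT -B0; apply: le_measure; rewrite ?inE//.
  exact: measurableI.
have [w w0 wE] := lebesgue_oball1 _ lamE.
pose q : R := ((s2 - s1) ^+ n * w)%R.
have q0 : (0 < q)%R by rewrite mulr_gt0 ?exprn_gt0.
have mE B : oball (s2 - s1) `<=` B -> m B = q%:E.
  move=> sB; rewrite /q EFinM -wE -lebesgue_oball//.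
  by apply: (congr1 lam); apply/seteqP; split => [y []//|y By]; split => //; exact: sB.
have [c [c0 lc cg]] := level_exceeds_ball _ _ _ ler01 s2S.
have /(distribution_lower _ _ n0 lamE gdec m c s1 s2 (l * q) mlam (ltW c0) cg) ls :
    (l * q)%:E < c%:E * m (oball (s2 - s1)).
  by rewrite mE// -EFinM lte_fin ltr_pM2r// (lt_le_trans lc)// mulr1.
have := weak_type_measure _ _ gdec sfin m r A (l * q) mlam bound (mulr_gt0 l0 q0).
rewrite mE//; set D := lam [set x | (l * q)%:E < `|Tg_meas g m x|] in ls *.
rewrite mulrC EFinM -muleA [in leRHS]muleC lee_pmul2l ?lte_fin// => lA.
have : a `^ r^-1 < (lam (oball s1)) `^ r^-1.
  by rewrite ltNge le_poweR2r ?invr_gt0// -ltNge.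
rewrite aK ltNge => /negP; apply.
rewrite -(@lee_pmul2l _ l%:E) ?lte_fin// -EFinM [in leRHS]mulrC divfK ?gt_eqF//.
by apply: le_trans lA; rewrite lee_pmul2l ?lte_fin// le_poweR2r ?invr_gt0// measure_ge0.
Qed.


(** * The dilates V_t and their limiting distribution *)

Hypotheses (VT : V setT < +oo) (Vlam : V `<< lam).

(** Absolute continuity survives dilation because the preimage of a null set under y -> t y has
    measure t^(-n) times zero. *)
Lemma dil_finite_measure (t : R) : (0 < t)%R ->
  exists m : {finite_measure set Rn R n -> \bar R},
    [/\ m = dil V t :> (set _ -> \bar R), m `<< lam, m setT = V setT &
        forall k, m (oball (t * k)) = V (oball k)].
Proof.
move=> t0.
pose f := (fun y : Rn R n => t *: (y : 'rV[R]_n) : Rn R n).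
have mf : measurable_fun setT f by exact: measurable_scale.
pose m0 : {measure set Rn R n -> \bar R} := pushforward V f.
have [m mE] := finite_measure_pack _ _ _ (m0 mf) VT.
exists m; split => //.
- apply/null_content_dominatesP => B mB B0.
  rewrite mE; move/null_content_dominatesP : Vlam; apply.
    by rewrite -[X in measurable X]setTI; exact: measurable_scale.
  have := lebesgue_scale _ lamE t^-1 B; rewrite invr_gt0 invrK => /(_ t0 mB).
  by rewrite B0 mule0.
- by rewrite mE.
- move=> k; rewrite mE; apply: (congr1 V); apply/seteqP; split => x;
  by rewrite /f /oball /= enormZ gtr0_norm// ltr_pM2l.
Qed.

(** Continuity from below along the balls of positive integer radius, which exhaust the space. *)
Lemma mass_oball (b : \bar R) : b < V setT -> exists2 k : R, (0 < k)%R & b < V (oball k).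
Proof.
move=> bV; pose F (i : nat) : set (Rn R n) := oball i.+1%:R.
have FT : \bigcup_i F i = setT.
  apply/seteqP; split => // x _; exists (Num.truncn (enorm (x : 'rV_n))) => //.
  exact: truncnS_gt.
have : (V \o F) x @[x --> \oo] --> V (\bigcup_i F i).
  apply: nondecreasing_cvg_mu.
  - by move=> i; exact: measurable_oball.
  - by rewrite FT.
  - move=> i j ij; apply/subsetPset => x; rewrite /F /oball /= => xi.
    by rewrite (lt_le_trans xi)// ler_nat ltnS.
rewrite FT => VF.
have [N _ NF] := VF _ (open_nbhs_nbhs (conj (@open_ereal_gt_ereal R b) bV)).
by exists N.+1%:R => //; exact: (NF N (leqnn N)).
Qed.

Let vE : V setT = (fine (V setT))%:E.
Proof. by rewrite fineK// ge0_fin_numE. Qed.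

Let v0 : (0 <= fine (V setT))%R.
Proof. exact: fine_ge0. Qed.

Lemma liminf_distribution (l : R) : (0 < l)%R ->
  lam [set x | l%:E < `|(g x)%:E * V setT|] <=
  limf_einf (fun t : R => lam [set x | l%:E < `|Tg_meas g (dil V t) x|]) 0^'+.
Proof.
move=> l0; set L := limf_einf _ _.
have L0 : 0 <= L.
  by apply: limf_einf_ge; apply: nearW => t; exact: measure_ge0.
(* If the claim failed, two balls would fit strictly between [L] and the level set in measure. The
   distribution eventually dominates the smaller ball, hence so does [L], which is absurd. *)
rewrite leNgt vE; apply/negP => LS.
have [s2 s20 /andP[Ls2 s2S]] := lebesgue_oball_between _ n0 lamE _ _ L0 LS.
have [s1 s10 /andP[+ s12]] := lebesgue_oball_between _ n0 lamE _ _ L0 Ls2.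
rewrite ltNge => /negP; apply; apply: limf_einf_ge.
have ds : (0 < s2 - s1)%R.
  rewrite subr_gt0 ltNge; apply/negP => s21.
  by move: s12; rewrite ltNge le_lebesgue_oball.
have [c [c0 lc cg]] := level_exceeds_ball _ _ _ v0 s2S.
have [k k0] : exists2 k : R, (0 < k)%R & (c^-1 * l)%:E < V (oball k).
  by apply: mass_oball; rewrite vE lte_fin mulrC ltr_pdivrMr// mulrC.
rewrite EFinM lte_pdivrMl// => lk.
near=> t.
have t0 : (0 < t)%R by near: t; exact: nbhs_right_gt.
(* For such t the ball of radius s2 - s1 contains that of radius t k, whose V_t-mass is the V-mass
   of the ball of radius k. *)
have tk : (t * k <= s2 - s1)%R.
  by rewrite -ler_pdivlMr//; near: t; apply: nbhs_right_ltW; rewrite divr_gt0.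
have [m [mE mlam _ mk]] := dil_finite_measure t t0.
rewrite -mE; apply: (distribution_lower _ _ n0 lamE gdec m c s1 s2) => //.
  exact: ltW.
apply: (lt_le_trans lk); rewrite -mk lee_pmul2l ?lte_fin//.
apply: le_measure; rewrite ?inE; try exact: measurable_oball.
by move=> x; rewrite /oball /= => xt; exact: lt_le_trans tk.
Unshelve. all: by end_near. Qed.

Lemma limsup_distribution (r A l : R) : (0 < r)%R -> (0 <= A)%R ->
  (forall f : Rn R n -> R, lam.-integrable setT (EFin \o f) ->
     weak_norm lam r (Tg_fun lam g f) <= A%:E * L1_norm lam f) ->
  (0 < l)%R ->
  limf_esup (fun t : R => lam [set x | l%:E < `|Tg_meas g (dil V t) x|]) 0^'+ <=
  lam [set x | l%:E <= `|(g x)%:E * V setT|].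
Proof.
move=> r0 A0 bound l0; rewrite vE; set v := fine _.
set a := lam [set x | l%:E <= `|(g x)%:E * v%:E|].
have a0 : 0 <= a by exact: measure_ge0.
have [->|ay] := eqVneq a +oo; first exact: leey.
have afin : a \is a fin_num by rewrite ge0_fin_numE// ltey.
apply/lee_addgt0Pr => e e0; have e20 : (0 < e / 2)%R by rewrite divr_gt0.
have ae : a < a + (e / 2)%:E by rewrite lteDl// lte_fin.
have [s2 s20 /andP[as2 s2e]] := lebesgue_oball_between _ n0 lamE _ _ a0 ae.
have [s1 s10 /andP[as1 s12]] := lebesgue_oball_between _ n0 lamE _ _ a0 as2.
have ds : (0 < s2 - s1)%R.
  rewrite subr_gt0 ltNge; apply/negP => s21.
  by move: s12; rewrite ltNge le_lebesgue_oball.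
have [c [c0 lc cg]] := ball_exceeds_level _ _ _ v0 as1.
rewrite -/v in lc.
pose eta : R := (l - c * v)%R; have eta0 : (0 < eta)%R by rewrite subr_gt0.
(* The mass allowed to escape: A d <= eta (e/2)^(1/r), so a measure of mass at most d has T_g above
   eta only on a set of measure at most e/2. The denominator A + 1 stays positive when A = 0. *)
pose d : R := (eta * (e / 2) `^ r^-1 / (A + 1))%R.
have d0 : (0 < d)%R by rewrite divr_gt0 ?mulr_gt0 ?powR_gt0// ltr_wpDl.
have [k k0 vk] : exists2 k : R, (0 < k)%R & (v - d)%:E < V (oball k).
  by apply: mass_oball; rewrite vE lte_fin gtrBl.
apply: limf_esup_le; near=> t.
have t0 : (0 < t)%R by near: t; exact: nbhs_right_gt.
have tk : (t * k <= s2 - s1)%R.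
  by rewrite -ler_pdivlMr//; near: t; apply: nbhs_right_ltW; rewrite divr_gt0.
have [m [mE mlam mT mk]] := dil_finite_measure t t0.
have mB := @measurable_oball R n (s2 - s1).
have mC : m (~` oball (s2 - s1)) < +oo.
  by rewrite ltey_eq fin_num_measure//; exact: measurableC.
pose m' : {finite_measure set Rn R n -> \bar R} := mfrestr (measurableC mB) mC.
have m'lam : m' `<< lam.
  apply/null_content_dominatesP => B mB0 B0.
  move/null_content_dominatesP : mlam => /(_ _ mB0 B0) B1.
  apply/eqP; rewrite eq_le measure_ge0 andbT -B1; apply: le_measure; rewrite ?inE//.
  by apply: measurableI => //; exact: measurableC.
have m'd : m' setT <= d%:E.
  have -> : m' setT = m (~` oball (s2 - s1)) by apply: (congr1 m); rewrite setTI.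
  have : v%:E = m (oball (s2 - s1)) + m (~` oball (s2 - s1)).
    apply: etrans (esym (etrans mT vE)) _.
    by rewrite -[in LHS](setUv (oball (s2 - s1))) measureU// ?setICr//; exact: measurableC.
  have : (v - d)%:E < m (oball (s2 - s1)).
    apply: (lt_le_trans vk); rewrite -mk; apply: le_measure; rewrite ?inE//.
      exact: measurable_oball.
    by move=> x; rewrite /oball /= => xt; exact: lt_le_trans tk.
  have : m (~` oball (s2 - s1)) \is a fin_num.
    by rewrite fin_num_measure//; exact: measurableC.
  have : m (oball (s2 - s1)) \is a fin_num by rewrite fin_num_measure.
  case: (m _) => [p||]//= _; case: (m _) => [q||]//= _.
  by rewrite lte_fin -EFinD lee_fin => pd [] ?; lra.
have cle : c%:E * m setT + eta%:E <= l%:E.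
  have -> : m setT = v%:E by exact: etrans mT vE.
  by rewrite -EFinM -EFinD lee_fin /eta addrC subrK.
rewrite -mE; apply: le_trans (distribution_upper _ _ gdec m m' c s1 s2 l eta (ltW c0) _ cg cle) _ => //.
have -> : a + e%:E = (a + (e / 2)%:E) + (e / 2)%:E.
  by rewrite -addeA -EFinD -splitr.
(* The ball of radius s2 accounts for a + e/2 by its choice; the weak type bound for [m'] at level
   eta gives the other e/2. *)
apply: leeD; first exact: ltW.
rewrite -(@le_poweR2r _ _ _ r^-1) ?invr_gt0 ?measure_ge0//; last by rewrite lee_fin ltW.
have sfin := lebesgue_sigma_finite _ lamE.
have := weak_type_measure _ _ gdec sfin m' r A eta m'lam bound eta0.
move=> /le_trans/(_ (lee_wpmul2l _ m'd)).
rewrite lee_fin => /(_ A0) Ad.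
rewrite -(@lee_pmul2l _ eta%:E) ?lte_fin//; apply: (le_trans Ad).
rewrite poweR_EFin -!EFinM lee_fin /d mulrCA ler_piMr//.
  by rewrite mulr_ge0 ?powR_ge0// ltW.
by rewrite ler_pdivrMr ?mul1r ?lerDl// ltr_wpDl.
Unshelve. all: by end_near. Qed.

End Dilation.

Theorem theorem5p2 (R : realType) :
  exists C : R, (0 < C)%R /\
  forall (n : nat) (r : R) (lam : {measure set Rn R n -> \bar R})
         (V : {measure set Rn R n -> \bar R}) (g : Rn R n -> R),
    (1 <= n)%N -> (1 < r)%R ->
    is_lebesgue lam ->
    (V setT < +oo)%E -> V `<< lam ->
    pos_radial_decreasing g ->
    (Tg_opnorm lam r g < +oo)%E ->
    [/\ (weak_norm lam r (EFin \o g) <= C%:E * Tg_opnorm lam r g)%E,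
        (forall l : R, (0 < l)%R ->
           (lam [set x | (l%:E < `|(g x)%:E * V setT|)%E]
            <= limf_einf (fun t : R =>
                 lam [set x | (l%:E < `|Tg_meas g (dil V t) x|)%E]) 0^'+)%E) &
        (forall l : R, (0 < l)%R ->
           (limf_esup (fun t : R =>
                 lam [set x | (l%:E < `|Tg_meas g (dil V t) x|)%E]) 0^'+
            <= lam [set x | (l%:E <= `|(g x)%:E * V setT|)%E])%E)].
Proof.
exists 1; split => // n r lam V g n0 r1 lamE VT Vlam gdec opfin.
have r0 : 0 < r by exact: lt_trans r1.
split=> [|l l0|l l0].
- by rewrite mul1e; exact: weak_norm_le_opnorm.
- exact: liminf_distribution.
(* A finite infimum provides at least one admissible constant A; any one suffices here. *)
- have [_ [A [A0 bound] <-] _] := ereal_inf_lt opfin.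
  exact: limsup_distribution r0 A0 bound l0.
Qed.
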